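(* For $a\in A$, the subspace $Ka$ is Kummer if and only if $KaK$ is Kummer.
   Context: Setting: $F$ is a field, $A$ is a central simple $F$-algebra of degree $n$ (so $\dim_F A=n^2$), and $K\subset A$ is a maximal subfield, separable over $F$, with $n=[K:F]$. $KaK$ denotes the $F$-span of all $kak'$ with $k,k'\in K$. For $x\in A$, $(-1)^i\rho_i(x)$ is the coefficient of $t^{n-i}$ in the (reduced) characteristic polynomial of $x$. An $F$-vector space $V\subseteq A$ is Kummer if $\rho_i(v)=0$ for every $v\in V$ and every $i\in\{1,\dots,n-1\}$. *)

(* Defs.v *)
From HB Require Import structures.
From mathcomp Require Import all_boot all_order all_algebra all_field.
From Stdlib Require Import ClassicalEpsilon.
Set Implicit Arguments.
Unset Strict Implicit.
Unset Printing Implicit Defensive.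

Import GRing.Theory.
Local Open Scope ring_scope.

Section CentralSimple.
Variables (F : fieldType) (A : falgType F).

(* Since A is unital, every two-sided ring ideal of A is an F-subspace, so it
   is enough to quantify over subspaces. *)
Definition two_sided_ideal (I : {vspace A}) : Prop :=
  ({:A} * I <= I)%VS /\ (I * {:A} <= I)%VS.

Definition central_simple : Prop :=
  'Z({:A})%VS = 1%VS /\
  forall I : {vspace A}, two_sided_ideal I -> I = 0%VS \/ I = {:A}%VS.

Definition is_subfield (M : {vspace A}) : Prop :=
  [/\ 1 \in M, (M * M <= M)%VS,
      {in M &, forall x y, x * y = y * x}
    & {in M, forall x, x != 0 -> x \is a GRing.unit /\ x^-1 \in M}].

Definition maximal_subfield (M : {vspace A}) : Prop :=
  is_subfield M /\
  forall M' : {vspace A}, is_subfield M' -> (M <= M')%VS -> M' = M.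

(* iota makes L an extension of F, and phi is an F-algebra morphism; the last
   clause says that the induced L-algebra morphism from the scalar extension
   of A to L into 'M[L]_n, x (x) l |-> l *: phi x, is bijective: it sends the
   L-basis b_j (x) 1 to an L-basis. *)
Definition splitting (n : nat) (L : fieldType) (iota : {rmorphism F -> L})
    (phi : {rmorphism A -> 'M[L]_n}) : Prop :=
  (forall (c : F) (x : A), phi (c *: x) = iota c *: phi x) /\
  basis_of {:'M[L]_n} [seq phi b | b <- vbasis {:A}].

Definition is_redcharpoly (n : nat) (x : A) (p : {poly F}) : Prop :=
  exists (L : fieldType) (iota : {rmorphism F -> L})
         (phi : {rmorphism A -> 'M[L]_n}),
    splitting iota phi /\ map_poly iota p = char_poly (phi x).

(* For A central simple of degree n, exactly one p satisfies is_redcharpoly n x: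
   A has a splitting field, and the characteristic polynomial of phi x has its
   coefficients in F and does not depend on the splitting. *)
Definition redcharpoly (n : nat) (x : A) : {poly F} :=
  epsilon (inhabits 0) (is_redcharpoly n x).

Definition rho (n i : nat) (x : A) : F :=
  (-1) ^+ i * (redcharpoly n x)`_(n - i).

Definition Kummer (n : nat) (V : {vspace A}) : Prop :=
  forall v, v \in V -> forall i, (0 < i < n)%N -> rho n i v = 0.

End CentralSimple.

(* Main.v *)
Require Import Defs.
From mathcomp Require Import all_boot all_order all_fingroup all_algebra all_field.
From HB Require Import structures.
From Stdlib Require Import Classical_Prop ClassicalEpsilon.
Set Implicit Arguments.
Unset Strict Implicit.
Unset Printing Implicit Defensive.
Import GRing.Theory.
Local Open Scope ring_scope.

(** Only the passage from [K a] to [K a K] needs an argument: [K a] lies in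
    [K a K] because 1 is in [K].

    Over a field [E] that splits the minimal polynomial of a generator of [K],
    the algebra [A] becomes the full matrix algebra, and a basis of common
    eigenvectors of [K] turns [k] in [K] into the diagonal matrix with entries
    [sigma_1 k, ..., sigma_n k], where the [sigma_i] are the [n] embeddings of
    [K] in [E] ([exists_diagonal_splitting]).  Write [M] for the matrix of [a].
    The i-th coefficient of the characteristic polynomial of [k a] is then, up
    to sign, the sum over the sets [S] of [i] indices of the principal minor of
    [M] on [S] times the product over [S] of the [sigma_s k].  This is a
    multilinear polynomial in the linearly independent functions [sigma_s], and
    such a polynomial vanishes on [K] only if its coefficients are all zero
    ([multilinear_eq0]); this holds over finite fields too.  So [K a] is Kummer
    exactly when every principal minor of [M] of size 1, ..., n-1 is zero.

    That condition depends only on the support of [M] ([pminor_support]).  Take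
    a smallest nonempty set [S] of indices with fewer than [n] elements that
    carries a permutation along nonzero entries of [M].  By minimality this
    permutation is unique ([smaller_cycle]), so the minor on [S] is a single
    nonzero term, a contradiction.  Hence no term of any proper principal minor
    survives, and this passes to every matrix whose support is contained in the
    support of [M].  The matrices of the elements of [K a K] are of this kind,
    since multiplying by diagonal matrices on both sides creates no new nonzero
    entry.

    The remaining work identifies the reduced characteristic polynomial.  In
    any splitting, the n-th power of the characteristic polynomial of [phi x]
    is the characteristic polynomial of right multiplication by [x] on [A]
    ([splitting_char_poly]), and a monic polynomial is determined by its n-th
    power ([monic_exp_inj]).  This makes the polynomial independent of the
    splitting.  Applied to the conjugates of one splitting over [K], it also
    shows that the coefficients lie in [F] ([redcharpoly_exists]).  The
    splitting over [K] is the action of [A] by right multiplication on itself,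
    regarded as a left [K]-space of dimension [n]; that it is a splitting
    comes from the central simplicity of [A] ([two_sided_free]). *)

(** * Principal minors and the characteristic polynomial *)

Section PrincipalMinors.
Variables (R : comNzRingType) (n : nat).
Implicit Types (M : 'M[R]_n) (S : {set 'I_n}).

(** The principal minor of [M] on [S], as a sum over the permutations that move
    only elements of [S]: this avoids renumbering [S], and each term is a
    product of entries of [M] along cycles in [S]. *)
Definition pminor M S : R :=
  \sum_(s : 'S_n | perm_on S s) (-1) ^+ s * \prod_(i in S) M i (s i).

Lemma pminor_scale_rows (d : 'I_n -> R) M S :
  pminor (\matrix_(i, j) (d i * M i j)) S = (\prod_(i in S) d i) * pminor M S.
Proof.
rewrite mulr_sumr; apply: eq_bigr => s _; rewrite mulrCA -big_split.
by congr (_ * _); apply: eq_bigr => i _; rewrite mxE.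
Qed.

(** Each factor of a term of the determinant of ['X - M] is the sum of an entry
    of [- M] and of ['X] or 0.  Once the products are expanded, the set [S] of
    indices where the entry of [- M] is chosen must contain every index that the
    permutation moves. *)
Lemma char_poly_pminor M :
  char_poly M = \sum_(S : {set 'I_n}) (-1) ^+ #|S| *: ((pminor M S) *: 'X^(n - #|S|)).
Proof.
rewrite /char_poly /determinant.
pose f (s : 'S_n) i : {poly R} := - (M i (s i))%:P.
pose g (s : 'S_n) i : {poly R} := 'X *+ (i == s i).
have E (s : 'S_n) :
  \prod_i char_poly_mx M i (s i) =
    \sum_(S : {set 'I_n}) \prod_i (if i \in S then f s i else g s i).
  rewrite -bigA_distr; apply: eq_bigr => i _; rewrite !mxE addrC.
  by rewrite /f /g; congr (_ + _).
under eq_bigr => s _ do rewrite E mulr_sumr.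
rewrite exchange_big; apply: eq_bigr => S _ /=.
rewrite (bigID (perm_on S)) /= [X in _ + X]big1 ?addr0 => [|s /subsetPn[i]]; last first.
  rewrite inE => si iS; rewrite (bigD1 i) //= (negPf iS) /g eq_sym (negPf si).
  by rewrite mulr0n mul0r mulr0.
rewrite scaler_suml scaler_sumr; apply: eq_bigr => s sS.
rewrite (bigID (mem S)) /= (eq_bigr (f s)) => [|i ->//].
rewrite [X in _ * (_ * X)](eq_bigr (fun=> 'X)) => [|i iS]; last first.
  by rewrite (negPf iS) /g (out_perm sS) // eqxx.
rewrite prodrN prodr_const.
have -> : #|[predC S]| = (n - #|S|)%N.
  by rewrite -[X in (X - _)%N]card_ord -(cardC S) addKn.
rewrite -(rmorph_prod (@polyC R)) /=.
set c := \prod_(i in S) _.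
rewrite -!mul_polyC rmorphM !rmorph_sign /=.
by rewrite !mulrA [_ ^+ s * _]mulrC.
Qed.

Lemma coef_char_poly M i : (i <= n)%N ->
  (char_poly M)`_(n - i) = (-1) ^+ i * \sum_(S : {set 'I_n} | #|S| == i) pminor M S.
Proof.
move=> le_in; rewrite char_poly_pminor coef_sum (bigID (fun S => #|S| == i)) /=.
rewrite [X in _ + X]big1 ?addr0 => [|S nSi].
  rewrite mulr_sumr; apply: eq_bigr => S /eqP ->.
  by rewrite !coefZ coefXn eqxx mulr1.
have le_Sn : (#|S| <= n)%N by rewrite -[X in (_ <= X)%N]card_ord max_card.
rewrite !coefZ coefXn eqn_sub2lE // eq_sym (negPf nSi) !mulr0 //.
Qed.

End PrincipalMinors.

(** * Multilinear polynomials in independent additive functions *)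

(** Induction on the degree of the polynomial, by finite differences.  The
    difference [P (v + w) - P v] is again multilinear in [v], of smaller degree,
    so that its coefficients vanish for every [w].  The coefficients just below
    the top degree are linear combinations of the [f i w], whose coefficients
    are top coefficients of [P]: these vanish by independence.  The method
    takes no account of the size of the field. *)
Lemma multilinear_eq0 (E : comNzRingType) (V : zmodType) (I : finType)
    (f : I -> {additive V -> E}) :
    (forall c : I -> E, (forall v, \sum_i c i * f i v = 0) -> forall i, c i = 0) ->
  forall c : {set I} -> E,
    (forall v, \sum_S c S * \prod_(i in S) f i v = 0) -> forall S, c S = 0.
Proof.
move=> f_free c; have: forall S : {set I}, (#|I| < #|S|)%N -> c S = 0.
  by move=> S; rewrite ltnNge max_card.
elim: #|I| c => [|m IHm] c c_deg c_eq0.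
  have c0 (S : {set I}) : S != set0 -> c S = 0 by rewrite -card_gt0; apply: c_deg.
  move=> S; case: (eqVneq S set0) => [->|/c0//].
  have := c_eq0 0; rewrite (bigD1 set0) //= big_set0 mulr1 big1 ?addr0 // => T /c0->.
  by rewrite mul0r.
have top0 (S0 : {set I}) : #|S0| = m.+1 -> c S0 = 0.
  move=> cardS0; have /card_gt0P[s0 S0s0] : (0 < #|S0|)%N by rewrite cardS0.
  pose T := S0 :\ s0.
  have cardT : #|T| = m by move: cardS0; rewrite (cardsD1 s0) S0s0 => -[].
  pose e s := if s \in T then 0 else c (s |: T).
  suffices /f_free/(_ s0) : forall w, \sum_s e s * f s w = 0.
    by rewrite /e setD11 setD1K.
  clearbody T => w.
  (* d U is the coefficient of the product over U in the value at v + w. *)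
  pose d (U : {set I}) := \sum_(S : {set I} | U \subset S) c S * \prod_(i in S :\: U) f i w.
  have d_deg (S : {set I}) : (m < #|S|)%N -> d S - c S = 0.
    move=> lt_m_S; rewrite /d (bigD1 S) //= setDv big_set0 mulr1 big1 ?addr0 ?subrr //.
    move=> S' /andP[sSS' neqS']; rewrite c_deg ?mul0r //.
    by apply: leq_ltn_trans lt_m_S (proper_card _); rewrite properEneq eq_sym neqS'.
  have d_eq0 v : \sum_S (d S - c S) * \prod_(i in S) f i v = 0.
    apply: etrans (subrr 0); rewrite -[X in _ = X - _](c_eq0 (v + w)).
    rewrite -[X in _ = _ - X](c_eq0 v).
    under eq_bigr => S _ do rewrite mulrBl.
    rewrite sumrB; congr (_ - _); rewrite /d.
    under eq_bigr => S _ do rewrite mulr_suml.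
    rewrite (exchange_big_dep xpredT) //=; apply: eq_bigr => S _.
    pose g1 i := if i \in S then f i v else 0.
    pose g2 i := if i \in S then f i w else 1.
    have -> : \prod_(i in S) f i (v + w) = \prod_i (g1 i + g2 i).
      rewrite [RHS](bigID (mem S)) /= [X in _ = _ * X]big1 ?mulr1 => [|i /negPf iS].
        by apply: eq_bigr => i iS; rewrite raddfD /g1 /g2 iS.
      by rewrite /g1 /g2 iS add0r.
    rewrite bigA_distr mulr_sumr [RHS](bigID (fun U : {set I} => U \subset S)) /=.
    rewrite [X in _ = _ + X]big1 ?addr0 => [|U /subsetPn[i iU iS]]; last first.
      by rewrite (bigD1 i) //= iU /g1 (negPf iS) mul0r mulr0.
    apply: eq_bigr => U sUS; rewrite -mulrA; congr (_ * _).
    rewrite mulrC [RHS](bigID (mem U)) /=; congr (_ * _).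
      by apply: eq_bigr => i iU; rewrite iU /g1 (subsetP sUS).
    rewrite [RHS](bigID (mem S)) /= [X in _ = _ * X]big1 ?mulr1; last first.
      by move=> i /andP[/negPf-> /negPf iS]; rewrite /g2 iS.
    apply: eq_big => [i|i]; first by rewrite !inE.
    by rewrite !inE => /andP[/negPf-> iS]; rewrite /g2 iS.
  have := IHm _ d_deg d_eq0 T; rewrite /d.
  rewrite (bigD1 T) //= setDv big_set0 mulr1 addrAC subrr add0r => dT.
  rewrite -[RHS]dT (bigID (mem T)) /= big1 ?add0r => [|i iT]; last first.
    by rewrite /e iT mul0r.
  rewrite [RHS](bigID (fun S : {set I} => #|S| == m.+1)) /=.
  rewrite [X in _ = _ + X]big1 ?addr0; last first.
    move=> S /andP[/andP[sTS neqS] neq_m]; rewrite c_deg ?mul0r //.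
    rewrite ltn_neqAle eq_sym neq_m -cardT.
    by apply: proper_card; rewrite properEneq eq_sym neqS.
  (* The sets of size m + 1 that contain T are the sets s |: T, s not in T. *)
  pose h' (S : {set I}) := odflt s0 [pick s in S :\: T].
  have h'P s : s \notin T -> h' (s |: T) = s.
    rewrite /h' => sT; case: pickP => [t|/(_ s)/=]; last by rewrite !inE sT eqxx.
    by rewrite /= !inE; case: (t \in T) => //=; rewrite orbF => /eqP.
  rewrite (reindex_onto (fun s => s |: T) h') /=.
    apply: eq_big => [s|s sT].
      case: (boolP (s \in T)) => sT /=.
        have -> : s |: T = T by apply/setUidPr; rewrite sub1set.
        by rewrite eqxx !andbF.
      rewrite h'P // subsetUr cardsU1 sT cardT !eqxx !andbT.
      by apply/esym/eqP => eqT; move: sT; rewrite -eqT setU11.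
    rewrite /e (negPf sT); congr (_ * _); apply/esym.
    have -> : (s |: T) :\: T = [set s].
      by apply/setP => t; rewrite !inE; case: eqVneq => [->|_]; rewrite ?sT //= andNb.
    by rewrite big_set1.
  move=> S /andP[/andP[sTS neqS] /eqP cardS].
  have : #|S :\: T| == 1%N by rewrite cardsD (setIidPr sTS) cardS cardT subSnn.
  case/cards1P => s defs; have sT : s |: T = S.
    by rewrite -defs setUC -{2}(setID S T) (setIidPr sTS).
  by rewrite -{1}sT h'P ?sT //; have := set11 s; rewrite -defs inE => /andP[].
apply: IHm => // S; rewrite leq_eqVlt => /orP[/eqP/esym/top0|/c_deg] //.
Qed.

(** * Vanishing of the proper principal minors depends on the support *)

(** Iterating [f] from [A], the images decrease until they stabilise. *)
Lemma stable_subset_bij (T : finType) (f : T -> T) (A : {set T}) :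
    A != set0 -> f @: A \subset A ->
  exists2 B : {set T}, B \subset A & B != set0 /\ f @: B = B.
Proof.
elim: {A}_.+1 {-2}A (ltnSn #|A|) => // m IHm A; rewrite ltnS => cardA A0 sfA.
case: (eqVneq (f @: A) A) => [fA|nfA]; first by exists A.
have pfA : f @: A \proper A by rewrite properEneq nfA.
have [||B sBA [B0 fB]] := IHm _ (leq_trans (proper_card pfA) cardA).
- by case/set0Pn: A0 => x xA; apply/set0Pn; exists (f x); rewrite imset_f.
- exact: imsetS.
by exists B => //; apply: subset_trans sBA sfA.
Qed.

Section Support.
Variables (R : idomainType) (n : nat).
Implicit Types (M N : 'M[R]_n) (S : {set 'I_n}).

(** Two permutations of [S] along nonzero entries that differ at [x] yield a
    self-map of [S]: follow [s], except at [x], where [t] is followed.  As [s x]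
    is no longer reached, this map is not onto, and the part of [S] on which
    it is bijective is a proper subset. *)
Lemma smaller_cycle M S (s t : {perm 'I_n}) :
    perm_on S s -> perm_on S t -> s != t ->
    \prod_(i in S) M i (s i) != 0 -> \prod_(i in S) M i (t i) != 0 ->
  exists2 S' : {set 'I_n}, S' \proper S /\ S' != set0 &
    exists2 u : {perm 'I_n}, perm_on S' u & \prod_(i in S') M i (u i) != 0.
Proof.
move=> sS tS neq_st /prodf_neq0 Ms /prodf_neq0 Mt.
have [x neq_x] : exists x, s x != t x.
  apply/existsP; apply: contraNT neq_st => /existsPn eq_st.
  by apply/eqP/permP => x; apply/eqP; rewrite -[_ == _]negbK eq_st.
have xS : x \in S.
  by apply: contraNT neq_x => xS; rewrite !(out_perm _ xS).
pose f y := if y == x then t x else s y.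
have fS y : y \in S -> f y \in S.
  by rewrite /f => yS; case: eqP => _; rewrite perm_closed.
have Mf y : y \in S -> M y (f y) != 0.
  by rewrite /f => yS; case: (y =P x) => [->|_]; [apply: Mt | apply: Ms].
have sx_f y : f y != s x.
  rewrite /f; case: (eqVneq y x) => [_|neq_y]; first by rewrite eq_sym.
  by apply: contraNneq neq_y => /perm_inj ->.
have sfS : f @: S \subset S by apply/subsetP => _ /imsetP[y yS ->]; apply: fS.
have [||B sBS [B0 fB]] := @stable_subset_bij _ f (f @: S).
- by apply/set0Pn; exists (f x); rewrite imset_f.
- exact: imsetS.
have f_inj : {in B &, injective f} by apply/imset_injP; rewrite fB.
have fBB y : y \in B -> f y \in B by move=> yB; rewrite -fB imset_f.
pose g y := if y \in B then f y else y.
have g_inj : injective g.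
  move=> y z; rewrite /g; case: ifP => yB; case: ifP => zB //; first exact: f_inj.
    by move=> E; rewrite -E fBB in zB.
  by move=> E; rewrite E fBB in yB.
have sBS' := subset_trans sBS sfS.
exists B; first split=> //.
  rewrite properEneq sBS' andbT; apply/eqP => eqBS.
  have /(subsetP sBS)/imsetP[y _ /esym/eqP] : s x \in B by rewrite eqBS perm_closed.
  by rewrite (negPf (sx_f y)).
exists (perm g_inj).
  by apply/subsetP => y; rewrite inE permE /g; case: ifP => // _; rewrite eqxx.
apply/prodf_neq0 => y yB; rewrite permE /g yB; apply: Mf; exact: (subsetP sBS').
Qed.

(** By induction on [S], all terms of the minor of [M] on [S] vanish: by
    [smaller_cycle] at most one term could be nonzero, and the minor would then
    equal this term. *)
Lemma pminor_support M N :
    (forall S, (0 < #|S| < n)%N -> pminor M S = 0) ->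
    (forall i j, M i j = 0 -> N i j = 0) ->
  forall S, (0 < #|S| < n)%N -> pminor N S = 0.
Proof.
move=> M0 sNM.
suffices noM S : (0 < #|S| < n)%N ->
    forall s : {perm 'I_n}, perm_on S s -> \prod_(i in S) M i (s i) = 0.
  move=> S /noM{}noM; rewrite /pminor big1 // => s /noM/eqP.
  rewrite prodf_seq_eq0 => /hasP[i _ /andP[iS /eqP Mi]].
  by rewrite (bigD1 i) //= sNM // mul0r mulr0.
elim: {S}_.+1 {-2}S (ltnSn #|S|) => // m IHm S; rewrite ltnS => cardS lt_S_n s sS.
apply/eqP/negPn/negP => Ms.
have : pminor M S == 0 by rewrite M0.
rewrite /pminor (bigD1 s) //= [X in _ + X]big1 ?addr0 => [|t /andP[tS neq_ts]].
  by rewrite mulf_eq0 signr_eq0 (negPf Ms).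
apply/eqP; rewrite mulf_eq0 signr_eq0; apply/negPn/negP => Mt.
have [S' [prS' S'0] [u uS' /negP[]]] := smaller_cycle tS sS neq_ts Mt Ms.
have lt_S' := proper_card prS'.
apply/eqP; apply: IHm => //; first exact: leq_trans lt_S' cardS.
by rewrite card_gt0 S'0 (ltn_trans lt_S') //; case/andP: lt_S_n.
Qed.

End Support.

(** * Comparison with the regular representation *)

Lemma monic_exp_inj (F : fieldType) n (p q : {poly F}) :
  (0 < n)%N -> p \is monic -> q \is monic -> p ^+ n = q ^+ n -> p = q.
Proof.
move=> n_gt0 mp mq eq_pq; apply/eqP; rewrite -eqp_monic //.
by apply/andP; split; rewrite -(dvdp_pexp2r _ _ n_gt0) eq_pq dvdpp.
Qed.

Lemma char_poly_similar (L : fieldType) m m' (A : 'M[L]_m) (A' : 'M[L]_m')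
    (B : 'M[L]_(m, m')) :
  m = m' -> row_free B -> B *m A' = A *m B -> char_poly A = char_poly A'.
Proof.
move=> eq_m; case: _ / eq_m => /= in A' B *.
rewrite row_free_unit => uB BA; rewrite /char_poly /char_poly_mx.
have cB : (map_mx polyC B : 'M[{poly L}]_m) \in unitmx by rewrite map_unitmx.
apply: (@mulIr _ (\det (map_mx polyC B : 'M[{poly L}]_m))) => //.
have eq_mx : ('X%:M - map_mx polyC A) *m map_mx polyC B
    = map_mx polyC B *m ('X%:M - map_mx polyC A').
  by rewrite mulmxBl mulmxBr -!map_mxM BA scalar_mxC.
by rewrite -det_mulmx eq_mx det_mulmx mulrC.
Qed.

Section RowVectorization.
Variables (L : fieldType) (n : nat).

(** The rows of [M] put side by side.  The recursion follows that of the product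
    [m * n], so that the matrices below are block matrices without casts. *)
Fixpoint row_vec m : 'M[L]_(m, n) -> 'rV[L]_(m * n) :=
  if m is m'.+1 return 'M_(m, n) -> 'rV_(m * n) then
    fun M : 'M_(1 + m', n) => row_mx (usubmx M) (row_vec (dsubmx M))
  else fun=> 0.

Fixpoint repeat_diag (X : 'M[L]_n) m : 'M[L]_(m * n) :=
  if m is m'.+1 return 'M_(m * n) then block_mx X 0 0 (repeat_diag X m') else 0.

Lemma row_vec_is_linear m : linear (@row_vec m).
Proof.
elim: m => [|m IHm] c M N; first by rewrite /= scaler0 addr0.
by rewrite /= !linearP /= IHm scale_row_mx add_row_mx.
Qed.

HB.instance Definition _ m :=
  GRing.isLinear.Build L _ _ _ (@row_vec m) (@row_vec_is_linear m).

Lemma row_vec_eq0 m (M : 'M_(m, n)) : row_vec M = 0 -> M = 0.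
Proof.
elim: m M => [|m IHm] M /=; first by rewrite [M]flatmx0.
rewrite -row_mx0 => /eq_row_mx[M1 /IHm M2].
by rewrite -[M](@vsubmxK _ 1 m) M1 M2 col_mx0.
Qed.

Lemma row_vec_mul m (M : 'M_(m, n)) X :
  row_vec (M *m X) = row_vec M *m repeat_diag X m.
Proof.
elim: m M => [|m IHm] M /=; first by rewrite mul0mx.
have -> : M *m X = col_mx (@usubmx _ 1 m n M *m X) (@dsubmx _ 1 m n M *m X).
  by rewrite -mul_col_mx vsubmxK.
rewrite col_mxKu col_mxKd.
by rewrite mul_row_block IHm !mulmx0 addr0 add0r.
Qed.

Lemma char_poly_repeat_diag X m :
  char_poly (repeat_diag X m) = char_poly X ^+ m.
Proof.
elim: m => [|m IHm]; first by rewrite /char_poly det_mx00.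
by rewrite /= /char_poly char_block_diag_mx det_ublock exprS -IHm.
Qed.

End RowVectorization.

Definition regmx (F : fieldType) (A : falgType F) (x : A) :
    'M[F]_(\dim {:A}) :=
  \matrix_(i, j) coord (vbasis {:A}) j ((vbasis {:A})`_i * x).

(** Right multiplication by [phi x] on the n x n matrices acts on each of the
    [n] rows separately, which gives the n-th power.  The images of a basis of
    [A] form a basis of these matrices, and in it right multiplication by
    [phi x] has the same matrix as right multiplication by [x]. *)
Lemma splitting_char_poly (F : fieldType) (A : falgType F) n (L : fieldType)
    (iota : {rmorphism F -> L}) (phi : {rmorphism A -> 'M[L]_n}) x :
  splitting iota phi ->
  map_poly iota (char_poly (regmx x)) = char_poly (phi x) ^+ n.
Proof.
case=> phiZ phi_basis; set b := vbasis {:A}.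
have phi_sum (k : 'I_(\dim {:A}) -> F) :
    phi (\sum_j k j *: b`_j) = \sum_j iota (k j) *: phi b`_j.
  by rewrite rmorph_sum; apply: eq_bigr => j _; rewrite phiZ.
have dimA : \dim {:A} = (n * n)%N.
  by rewrite -(size_basis phi_basis) dimvf dim_matrix.
pose B : 'M[L]_(\dim {:A}, n * n) := \matrix_i row_vec (phi b`_i).
have mulB (u : 'rV_(\dim {:A})) : u *m B = row_vec (\sum_i u 0 i *: phi b`_i).
  rewrite mulmx_sum_row linear_sum; apply: eq_bigr => i _.
  by rewrite linearZ rowK.
rewrite map_char_poly -char_poly_repeat_diag; apply: (char_poly_similar (B := B)) => //.
  rewrite -kermx_eq0; apply/eqP/row_matrixP => i; rewrite row0.
  have /sub_kermxP := row_sub i (kermx B); move: (row i _) => u.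
  rewrite mulB => /row_vec_eq0 u0; apply/rowP => j; rewrite [RHS]mxE.
  have /freeP phi_free : free [tuple of [seq phi v | v <- b]].
    exact: basis_free phi_basis.
  apply: (phi_free (fun j => u 0 j)); rewrite -[RHS]u0.
  by apply: eq_bigr => k _; rewrite (nth_map 0) ?size_tuple.
apply/row_matrixP => i; rewrite !row_mul rowK -row_vec_mul mulB; congr (row_vec _).
transitivity (phi (b`_i * x)); first by rewrite rmorphM.
rewrite (coord_vbasis (memvf (b`_i * x))) phi_sum.
by apply: eq_bigr => j _; rewrite !mxE.
Qed.

(** * Two-sided linear independence in central simple algebras *)

Section CentralSimpleAlgebras.
Variables (F : fieldType) (A : falgType F).

Lemma prodv_ind (U V : {vspace A}) (P : A -> Prop) :
    P 0 -> (forall x y, P x -> P y -> P (x + y)) ->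
    (forall u v, u \in U -> v \in V -> P (u * v)) ->
  forall w, w \in (U * V)%VS -> P w.
Proof.
move=> P0 PD PM w; rewrite unlock => /(coord_span (X := in_tuple _)) ->.
apply: big_ind => // i _; set X := in_tuple _.
have /allpairsP[[u v] /= [uU vV ->]] : X`_i \in X by rewrite mem_nth.
by rewrite scalerAl; apply: PM; [apply: rpredZ|]; apply: vbasis_mem.
Qed.

Hypothesis simpleA : central_simple A.

(** [P] holds on the whole two-sided ideal generated by [y]. *)
Lemma simple_ideal1 (P : A -> Prop) y :
    (forall u v, P u -> P v -> P (u + v)) ->
    (forall u v w, P v -> P (u * v * w)) ->
  P y -> y != 0 -> P 1.
Proof.
move=> PD PM Py y0; pose I := ({:A} * <[y]> * {:A})%VS.
have P0 : P 0 by rewrite -(mul0r 0) -[X in X * _](mul0r y); apply: PM.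
have [I0|I1] : I = 0%VS \/ I = fullv.
- apply: simpleA.2; split; first by rewrite /I 2!prodvA prodvSl ?subvf // prodvSl ?subvf.
  by rewrite /I -prodvA prodvSr ?subvf.
- have: y \in I by rewrite -[y]mulr1 -{1}[y]mul1r !memv_mul ?memvf ?memv_line.
  by rewrite I0 memv0 (negPf y0).
have: 1 \in I by rewrite I1 memvf.
apply: (prodv_ind (P := P)) => // _ w /memv_cosetP[u _ ->] _; exact: PM.
Qed.

(** The classical shortest relation argument.  The families [y] that satisfy the
    relation are stable under two-sided multiplication, so that simplicity
    allows a nonzero entry of a shortest one to be replaced by 1.  The
    commutators [u y i - y i u] then form a shorter family, hence vanish, the
    entries are central, thus scalars, and [v = 1] contradicts the
    independence of [b]. *)
Lemma two_sided_free (I : finType) (b : I -> A) :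
    (forall k : I -> F, \sum_i k i *: b i = 0 -> forall i, k i = 0) ->
  forall y : I -> A, (forall v, \sum_i y i * v * b i = 0) -> forall i, y i = 0.
Proof.
move=> b_free y; pose supp (z : I -> A) := [set i | z i != 0].
elim: {y}_.+1 {-2}y (ltnSn #|supp y|) => // m IHm y; rewrite ltnS => card_y rel_y i.
apply/eqP; apply/negPn/negP => yi0.
pose P z := exists y', [/\ forall v, \sum_i y' i * v * b i = 0,
  forall i, y i = 0 -> y' i = 0 & y' i = z].
have [y' [rel_y' supp_y' y'i]] : P 1.
  apply: (simple_ideal1 (y := y i)) => // [_ _ [y1 [r1 s1 <-]] [y2 [r2 s2 <-]]||].
  - exists (fun i => y1 i + y2 i); split=> // [v|k yk]; last by rewrite s1 ?s2 ?addr0.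
    under eq_bigr => k _ do rewrite !mulrDl.
    by rewrite big_split /= r1 r2 addr0.
  - move=> u _ w [y1 [r1 s1 <-]]; exists (fun i => u * y1 i * w).
    split=> // [v|k yk]; last by rewrite s1 ?mulr0 ?mul0r.
    transitivity (u * \sum_i y1 i * (w * v) * b i); last by rewrite r1 mulr0.
    rewrite mulr_sumr.
    by apply: eq_bigr => k _; rewrite !mulrA.
  - by exists y; split.
have y'_central k : y' k \in 'Z({:A})%VS.
  rewrite memv_cap memvf; apply/centvP => u _; apply/eqP; rewrite -subr_eq0; apply/eqP.
  move: k; apply: IHm.
    apply: leq_trans card_y; apply: proper_card; apply/properP; split.
      apply/subsetP => k; rewrite !inE; apply: contraNneq => /supp_y' ->.
      by rewrite mulr0 mul0r subrr.
    by exists i; rewrite !inE // y'i mul1r mulr1 subrr eqxx.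
  move=> v; under eq_bigr => k _ do rewrite !mulrBl.
  rewrite sumrB /= -[RHS](subrr 0) -[X in _ = X - _](rel_y' (u * v)).
  rewrite -[X in _ = _ - X](mulr0 u) -[X in _ = _ - u * X](rel_y' v) mulr_sumr.
  by congr (_ - _); apply: eq_bigr => k _; rewrite !mulrA.
have [k ky'] : exists k : I -> F, forall i, y' i = (k i)%:A.
  have y'_line l : exists c, y' l == c%:A.
    by have := y'_central l; rewrite simpleA.1 => /vlineP[c ->]; exists c.
  by exists (fun l => xchoose (y'_line l)) => l; apply/eqP/(xchooseP (y'_line l)).
have k0 : k i = 0.
  apply: b_free; rewrite -[RHS](rel_y' 1); apply: eq_bigr => l _.
  by rewrite mulr1 ky' mulr_algl.
by have /eqP := y'i; rewrite ky' k0 scale0r eq_sym oner_eq0.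
Qed.

End CentralSimpleAlgebras.

(** * The splitting given by a subfield of maximal dimension *)

Section RegularSplitting.
Variables (F : fieldType) (A : falgType F) (n : nat).
Variables (K : fieldExtType F) (j : {lrmorphism K -> A}).
Hypotheses (dimA : \dim {:A} = (n ^ 2)%N) (dimK : \dim {:K} = n).

Definition left_comb (e : nat -> A) m (f : {ffun 'I_m -> K}) : A :=
  \sum_(i < m) j (f i) * e i.

Lemma left_comb_is_linear e m : linear (@left_comb e m).
Proof.
move=> c f g; rewrite /left_comb scaler_sumr -big_split; apply: eq_bigr => i _ /=.
by rewrite !ffunE linearP mulrDl scalerAl.
Qed.

HB.instance Definition _ e m :=
  GRing.isLinear.Build F _ _ _ (@left_comb e m) (@left_comb_is_linear e m).

Lemma dim_ffun_ext m : \dim {: {ffun 'I_m -> K}} = (m * n)%N.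
Proof. by rewrite dimvf /dim /= card_ord -dimK dimvf. Qed.

(** Greedy construction: [m < n] elements span, with left coefficients in [K], a
    space of dimension at most [m * n], smaller than [n ^ 2], and any element
    outside of it can be added, since nonzero coefficients are invertible. *)
Lemma exists_left_free m : (m <= n)%N ->
  exists e : nat -> A, forall f, left_comb e f = 0 -> f = 0 :> {ffun 'I_m -> K}.
Proof.
elim: m => [|m IHm] lt_mn.
  by exists (fun=> 0) => f _; apply/ffunP => -[].
have [e e_free] := IHm (ltnW lt_mn).
have /subvPn[x _ x_notin] : ~~ ({:A} <= limg (linfun (left_comb e (m := m))))%VS.
  apply/negP => /dimvS; rewrite leqNgt => /negP[].
  apply: leq_ltn_trans (_ : m * n < _)%N; last first.
    by rewrite dimA -mulnn ltn_pmul2r // (leq_trans _ lt_mn).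
  rewrite -dim_ffun_ext.
  by rewrite -[X in (_ <= X)%N](limg_ker_dim (linfun (left_comb e (m := m)))) leq_addl.
exists (fun i => if i == m then x else e i) => f.
rewrite /left_comb big_ord_recr /= eqxx.
under eq_bigr => i _ do rewrite ltn_eqF //.
move=> f_rel; have fm0 : f ord_max = 0.
  apply/eqP; apply: contraR x_notin => fm; apply/memv_imgP.
  exists [ffun i : 'I_m => - (f ord_max)^-1 * f (widen_ord (leqnSn m) i)]; first exact: memvf.
  rewrite lfunE /= /left_comb.
  under eq_bigr => i _ do rewrite ffunE rmorphM -mulrA.
  rewrite -mulr_sumr (canRL (addrK _) f_rel) sub0r rmorphN mulrNN mulrA -rmorphM mulVf //.
  by rewrite rmorph1 mul1r.
have /e_free f0 : left_comb e [ffun i : 'I_m => f (widen_ord (leqnSn m) i)] = 0.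
  rewrite -[RHS]f_rel fm0 rmorph0 mul0r addr0.
  by apply: eq_bigr => i _; rewrite ffunE.
apply/ffunP => i; rewrite ffunE; case: (unliftP ord_max i) => [k ->|->//].
have /ffunP/(_ k) := f0; rewrite !ffunE => <-; congr (f _); apply: val_inj.
by rewrite /= /bump leqNgt ltn_ord.
Qed.

Lemma exists_left_basis : exists (e : 'I_n -> A) (c : A -> 'rV[K]_n),
  (forall x, \sum_i j (c x 0 i) * e i = x) /\
  (forall v : 'rV[K]_n, c (\sum_i j (v 0 i) * e i) = v).
Proof.
have [e e_free] := exists_left_free (leqnn n).
pose D := linfun (left_comb e (m := n)).
have kerD : lker D == 0%VS.
  apply/eqP/vspaceP => f; rewrite memv0 memv_ker lfunE /=.
  by apply/eqP/eqP => [/e_free|->] //; rewrite linear0.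
have imD : limg D = fullv.
  apply/eqP; rewrite eqEdim subvf limg_dim_eq; last by rewrite (eqP kerD) capv0.
  by rewrite dimA dim_ffun_ext mulnn leqnn.
exists (fun i => e i), (fun x => \row_i (D^-1)%VF x i); split=> [x|v].
  rewrite -[RHS](limg_lfunVK (_ : x \in limg D)) ?imD ?memvf // lfunE.
  by apply: eq_bigr => i _; rewrite mxE.
have -> : \sum_i j (v 0 i) * e i = D [ffun i => v 0 i].
  by rewrite lfunE; apply: eq_bigr => i _; rewrite ffunE.
by apply/rowP => i; rewrite mxE lker0_lfunK // ffunE.
Qed.


(** In the coordinates of a left [K]-basis of [A], right multiplication by [x]
    is [K]-linear and is given by a matrix acting on row vectors, hence a
    morphism in [x] and not an antimorphism.  A [K]-linear relation between
    the matrices of a basis of [A] reads as in [two_sided_free]. *)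
Lemma regular_splitting : central_simple A ->
  exists phi : {rmorphism A -> 'M[K]_n},
    splitting (in_alg K) phi /\ injective phi.
Proof.
move=> simpleA; have [e [c [eK cK]]] := exists_left_basis.
have eD (u v : 'rV[K]_n) : \sum_i j ((u + v) 0 i) * e i
    = \sum_i j (u 0 i) * e i + \sum_i j (v 0 i) * e i.
  by rewrite -big_split; apply: eq_bigr => i _; rewrite mxE rmorphD mulrDl.
have eZ k (v : 'rV[K]_n) : \sum_i j ((k *: v) 0 i) * e i = j k * \sum_i j (v 0 i) * e i.
  by rewrite mulr_sumr; apply: eq_bigr => i _; rewrite mxE rmorphM mulrA.
have cD x y : c (x + y) = c x + c y by rewrite -[in LHS](eK x) -[in LHS](eK y) -eD cK.
have cB x y : c (x - y) = c x - c y by rewrite -{2}(subrK y x) [in RHS]cD addrK.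
have cZ k x : c (j k * x) = k *: c x by rewrite -[in LHS](eK x) -eZ cK.
have c0 : c 0 = 0 by have := cZ 0 0; rewrite mulr0 scale0r.
have c_sum (I : Type) (r : seq I) (f : I -> A) : c (\sum_(i <- r) f i) = \sum_(i <- r) c (f i).
  exact: (big_morph c cD c0).
pose f x : 'M[K]_n := \matrix_s c (e s * x).
have cM x y : c (x * y) = c x *m f y.
  rewrite -[in LHS](eK x) mulr_suml c_sum mulmx_sum_row; apply: eq_bigr => s _.
  by rewrite -mulrA cZ rowK.
have f_add : zmod_morphism f.
  move=> x y; apply/row_matrixP => s; rewrite linearB /= !rowK.
  by rewrite mulrBr cB.
have f_mul : monoid_morphism f.
  split=> [|x y]; apply/row_matrixP => s; last by rewrite row_mul !rowK mulrA cM.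
  rewrite rowK mulr1 rowE mulmx1 -[RHS]cK; congr c.
  rewrite (bigD1 s) //= big1 ?addr0 => [|t ts]; rewrite mxE eqxx /=.
    by rewrite eqxx rmorph1 mul1r.
  by rewrite (negPf ts) rmorph0 mul0r.
pose fA := GRing.isZmodMorphism.Build A 'M[K]_n f f_add.
pose fM := GRing.isMonoidMorphism.Build A 'M[K]_n f f_mul.
pose phi : {rmorphism A -> 'M[K]_n} := HB.pack f fA fM.
have f_inj : injective f.
  move=> x y /(congr1 (mulmx (c 1))); rewrite -!cM !mul1r.
  move=> /(congr1 (fun v : 'rV[K]_n => \sum_i j (v 0 i) * e i)).
  by rewrite !eK.
exists phi; split=> //; split=> [a x|].
  apply/row_matrixP => s; rewrite /= linearZ /= !rowK.
  by rewrite -cZ /= rmorph_alg mulr_algl scalerAr.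
set b := vbasis {:A}.
rewrite basisEfree; apply/and3P; split; [|exact: subvf|]; last first.
  by rewrite size_map size_tuple dimvf dim_matrix dimA leqnn.
suff: free [tuple of [seq phi v | v <- b]] by [].
apply/freeP => k k0.
have b_free (k' : 'I_(\dim {:A}) -> F) : \sum_i k' i *: b`_i = 0 -> forall i, k' i = 0.
  by apply/freeP/(basis_free (vbasisP {:A})).
have jk0 := @two_sided_free F A simpleA 'I_(\dim {:A}) (fun i => b`_i) b_free (fun i => j (k i)).
move=> i; apply/eqP; rewrite -(fmorph_eq0 j); apply/eqP; move: i; apply: jk0 => v.
rewrite -[LHS]eK.
have -> : c (\sum_i j (k i) * v * b`_i) = 0.
  rewrite c_sum -[RHS](mulmx0 _ (c v)) -k0 mulmx_sumr; apply: eq_bigr => i _.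
  by rewrite -mulrA cZ cM -scalemxAr (nth_map 0) ?size_tuple.
by rewrite big1 // => i _; rewrite mxE rmorph0 mul0r.
Qed.

End RegularSplitting.

(** * The embeddings of a separable extension *)

Lemma exists_irreducible_factor (F : fieldType) (p : {poly F}) :
  (1 < size p)%N -> exists2 q, irreducible_poly q & q %| p.
Proof.
elim: {p}_.+1 {-2}p (ltnSn (size p)) => // m IHm p; rewrite ltnS => le_pm p_gt1.
case: (classic (irreducible_poly p)) => [|red_p]; first by exists p.
have p0 : p != 0 by rewrite -size_poly_eq0 -lt0n ltnW.
have [q [q1 q_dvd q_neq]] : exists q : {poly F}, [/\ size q != 1%N, q %| p & ~~ (q %= p)].
  apply: NNPP => no_q; apply: red_p; split=> // q q1 q_dvd.
  by apply/negPn/negP => q_neq; apply: no_q; exists q.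
have lt_qp : (size q < size p)%N.
  by rewrite ltn_neqAle dvdp_leq // andbT (dvdp_size_eqp q_dvd).
have q0 : (0 < size q)%N by rewrite size_poly_gt0 (dvdpN0 q_dvd).
have [|r irr_r r_dvd] := IHm q (leq_trans lt_qp le_pm).
  by rewrite ltn_neqAle eq_sym q1.
by exists r => //; apply: dvdp_trans q_dvd.
Qed.

Lemma exists_splitting_field (K : fieldType) (p : {poly K}) : p \is monic ->
  exists (E : fieldType) (iota : {rmorphism K -> E}) (rs : seq E),
    map_poly iota p = \prod_(z <- rs) ('X - z%:P).
Proof.
have [m] := ubnP (size p); elim: m K p => // m IHm K p; rewrite ltnS => le_pm mon_p.
have [p_le1|p_gt1] := leqP (size p) 1.
  exists K, idfun, [::]; rewrite big_nil map_poly_id //.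
  have p1 : size p == 1%N by rewrite eqn_leq p_le1 size_poly_gt0 monic_neq0.
  by have /size_poly1P[c _ def_p] := p1; rewrite def_p (_ : c = 1) //
    -(monicP mon_p) def_p lead_coefC.
have [q irr_q q_dvd] := exists_irreducible_factor p_gt1.
have [L _ [z qz _]] := irredp_FAdjoin irr_q.
have /factor_theorem[r def_p] : root (map_poly (in_alg L) p) z.
  by rewrite -(divpK q_dvd) rmorphM rootM qz orbT.
have mon_r : r \is monic.
  by rewrite -(monicMr r (monicXsubC z)) -def_p map_monic.
have lt_rm : (size r < m)%N.
  apply: leq_trans le_pm; rewrite -(size_map_poly (in_alg L) p) def_p.
  by rewrite size_Mmonic ?monic_neq0 ?monicXsubC // size_XsubC addn2.
have [E [iota [rs def_r]]] := IHm L r lt_rm mon_r.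
exists E, (iota \o in_alg L), (iota z :: rs).
rewrite big_cons -def_r map_poly_comp /= def_p rmorphM /= mulrC.
by rewrite rmorphB /= map_polyX map_polyC.
Qed.

(** Up to a scalar, the Lagrange interpolation polynomial at [z i]. *)
Lemma separating_poly (E : fieldType) (I : finType) (z : I -> E) i :
  injective z -> exists2 h : {poly E}, h.[z i] != 0 & forall k, k != i -> h.[z k] = 0.
Proof.
move=> z_inj; exists (\prod_(k | k != i) ('X - (z k)%:P)) => [|k ki].
  rewrite horner_prod; apply/prodf_neq0 => k ki; rewrite hornerXsubC subr_eq0.
  by apply: contraNneq ki => /z_inj->.
by rewrite horner_prod (bigD1 k) //= hornerXsubC subrr mul0r.
Qed.

Section Embeddings.
Variables (F : fieldType) (K : fieldExtType F) (n : nat).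
Hypotheses (sepK : separable 1 {:K}) (dimK : \dim {:K} = n).

(** The embeddings send a primitive element [theta] to the roots of its minimal
    polynomial, which are distinct by separability; an element of [K] is
    evaluated at a root through its expression as a polynomial in [theta]. *)
Lemma exists_embeddings : exists (E : fieldType)
    (sigma : 'I_n -> {rmorphism K -> E}) (theta : K),
  [/\ injective (fun i => sigma i theta),
      <<1; theta>>%VS = {:K}%VS,
      forall i k c, sigma i c%:A = sigma k c%:A
    & forall i, map_poly (sigma i) (minPoly 1 theta)
        = \prod_k ('X - (sigma k theta)%:P)].
Proof.
pose theta := separable_generator 1 {:K}%AS.
have gen_theta : <<1; theta>>%VS = {:K}%VS.
  by rewrite -(eq_adjoin_separable_generator sepK (sub1v _)).
pose p := minPoly 1 theta; pose g := Fadjoin_poly 1 theta.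
have gE k : (g k).[theta] = k by rewrite Fadjoin_poly_eq ?gen_theta ?memvf.
have mon_p : p \is monic by apply: monic_minPoly.
have [E [iota [rs def_p]]] := exists_splitting_field mon_p.
have uniq_rs : uniq rs.
  rewrite -separable_prod_XsubC -def_p separable_map; exact: separable_generatorP.
have size_rs : size rs = n.
  have := congr1 (fun q : {poly E} => (size q).-1) def_p.
  rewrite size_map_poly size_minPoly size_prod_XsubC /= => <-.
  by rewrite adjoin_degreeE gen_theta dimv1 divn1.
have root_rs i : (i < n)%N -> (map_poly iota p).[rs`_i] = 0.
  move=> lt_in; rewrite def_p; apply/rootP; rewrite root_prod_XsubC mem_nth ?size_rs //.
have g_mod q i : (i < n)%N -> q \is a polyOver 1%AS ->
    (map_poly iota (g q.[theta])).[rs`_i] = (map_poly iota q).[rs`_i].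
  move=> lt_in Fq; rewrite /g Fadjoin_poly_mod // -/p.
  rewrite [in RHS](divp_eq q p) rmorphD rmorphM hornerD hornerM /=.
  by rewrite root_rs // mulr0 add0r.
have exists_sigma (i : 'I_n) : exists s : {rmorphism K -> E},
    forall k, s k = (map_poly iota (g k)).[rs`_i].
  pose f k := (map_poly iota (g k)).[rs`_i].
  have f_add : zmod_morphism f by move=> x y; rewrite /f /g linearB rmorphB hornerD hornerN.
  have f_mul : monoid_morphism f.
    split=> [|x y].
      rewrite /f /g Fadjoin_polyC ?mem1v // map_polyC hornerC; exact: rmorph1.
    rewrite /f -[in LHS](gE x) -[in LHS](gE y) -hornerM g_mod //.
      by rewrite rmorphM hornerM.
    by rewrite rpredM ?Fadjoin_polyOver.
  pose fA := GRing.isZmodMorphism.Build K E f f_add.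
  pose fM := GRing.isMonoidMorphism.Build K E f f_mul.
  pose s : {rmorphism K -> E} := HB.pack f fA fM.
  by exists s.
have [sigma sigmaE] : exists sigma : 'I_n -> {rmorphism K -> E},
    forall i k, sigma i k = (map_poly iota (g k)).[rs`_i].
  exact: (fin_all_exists exists_sigma).
have sigma_theta i : sigma i theta = rs`_i.
  by rewrite sigmaE -[theta]hornerX g_mod ?polyOverX // map_polyX hornerX.
have sigmaF i c : sigma i c%:A = iota c%:A.
  by rewrite sigmaE /g Fadjoin_polyC ?rpredZ ?mem1v // map_polyC hornerC.
exists E, sigma, theta; split=> // [i k|i k c|i].
- rewrite !sigma_theta => /eqP; rewrite nth_uniq ?size_rs // => /eqP; exact: val_inj.
- by rewrite !sigmaF.
have -> : map_poly (sigma i) p = map_poly iota p.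
  apply/polyP => k; rewrite !coef_map /=.
  by have /polyOverP/(_ k)/vlineP[c ->] := minPolyOver 1 theta; rewrite sigmaF.
rewrite def_p (big_nth 0) size_rs big_mkord.
by apply: eq_bigr => k _; rewrite sigma_theta.
Qed.

End Embeddings.

(** * The reduced characteristic polynomial *)

Section EmbeddingProperties.
Variables (F : fieldType) (K : fieldExtType F) (n : nat) (E : fieldType).
Variables (sigma : 'I_n -> {rmorphism K -> E}) (theta : K).
Hypothesis sigma_inj : injective (fun i => sigma i theta).

(** The relation at the powers of [theta] gives the relation
    [\sum_i c i * h.[sigma i theta] = 0] for every polynomial [h] over [E], and
    a polynomial that vanishes at all but one of the conjugates isolates one
    coefficient. *)
Lemma embeddings_free (c : 'I_n -> E) :
  (forall k, \sum_i c i * sigma i k = 0) -> forall i, c i = 0.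
Proof.
move=> c_rel i; have [h hi h_else] := separating_poly i sigma_inj.
have : \sum_k c k * h.[sigma k theta] = 0.
  under eq_bigr => k _ do rewrite horner_coef mulr_sumr.
  rewrite exchange_big big1 //= => m _.
  rewrite -[RHS](mulr0 h`_m) -[X in _ = _ * X](c_rel (theta ^+ m)) mulr_sumr.
  by apply: eq_bigr => k _; rewrite rmorphXn /= mulrCA.
rewrite (bigD1 i) //= big1 ?addr0 => [|k ki]; last by rewrite h_else ?mulr0.
by move/eqP; rewrite mulf_eq0 (negPf hi) orbF => /eqP.
Qed.

Hypothesis gen_theta : <<1; theta>>%VS = {:K}%VS.

Lemma generator_poly k : exists q : {poly F}, k = (map_poly (in_alg K) q).[theta].
Proof.
have /Fadjoin_polyP[q /polyOver1P[q' ->] ->] : k \in <<1; theta>>%VS.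
  by rewrite gen_theta memvf.
by exists q'.
Qed.

Hypotheses (dimK : \dim {:K} = n)
  (sigmaF : forall i k c, sigma i c%:A = sigma k c%:A).

(** Write [k] as a polynomial [g] of degree less than [n] in [theta]: the
    polynomial obtained from [g] by subtracting the common value of the
    [sigma i k] vanishes at the [n] conjugates of [theta], so [g] is constant. *)
Lemma embeddings_fixed k :
  (forall i l, sigma i k = sigma l k) -> k \in 1%VS.
Proof.
move=> k_fixed; have n_gt0 : (0 < n)%N by rewrite -dimK adim_gt0.
pose i0 := Ordinal n_gt0; pose g := Fadjoin_poly 1 theta k.
have gE : g.[theta] = k by rewrite Fadjoin_poly_eq ?gen_theta ?memvf.
have size_g : (size g <= n)%N.
  by rewrite -dimK -gen_theta (leq_trans (size_Fadjoin_poly _ _ _)) //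
    adjoin_degreeE dimv1 divn1.
have map_g i : map_poly (sigma i) g = map_poly (sigma i0) g.
  apply/polyP => m; rewrite !coef_map /=.
  by have /polyOverP/(_ m)/vlineP[c ->] := Fadjoin_polyOver 1 theta k.
have g_const : map_poly (sigma i0) g = (sigma i0 k)%:P.
  apply/eqP; rewrite -subr_eq0; apply/eqP.
  apply: (@roots_geq_poly_eq0 _ _ [seq sigma i theta | i : 'I_n]).
  - apply/allP => _ /imageP[i _ ->]; rewrite /root hornerD hornerN hornerC.
    by rewrite -(map_g i) horner_map gE (k_fixed i i0) subrr.
  - by rewrite map_inj_uniq ?enum_uniq.
  rewrite size_map -cardE card_ord (leq_trans (size_polyD _ _)) // geq_max.
  by rewrite size_map_poly size_g size_polyN (leq_trans (size_polyC_leq1 _)).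
have size_g1 : (size g <= 1)%N by rewrite -(size_map_poly (sigma i0)) g_const size_polyC_leq1.
rewrite -gE (size1_polyC size_g1) hornerC.
exact: (polyOverP (Fadjoin_polyOver 1 theta k)).
Qed.

End EmbeddingProperties.

Lemma redcharpolyE (F : fieldType) (A : falgType F) n (L : fieldType)
    (iota : {rmorphism F -> L}) (phi : {rmorphism A -> 'M[L]_n}) x :
    (0 < n)%N -> splitting iota phi -> (exists p, is_redcharpoly n x p) ->
  map_poly iota (redcharpoly n x) = char_poly (phi x).
Proof.
move=> n_gt0 split_phi ex_p.
have [L' [iota' [phi' [split_phi' eq_p]]]] := epsilon_spec (inhabits 0) _ ex_p.
rewrite -/(redcharpoly n x) in eq_p.
have mon_p : redcharpoly n x \is monic by rewrite -(map_monic iota') eq_p char_poly_monic.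
have eq_reg : redcharpoly n x ^+ n = char_poly (regmx x).
  by apply: (map_poly_inj iota'); rewrite (splitting_char_poly _ split_phi') rmorphXn /= eq_p.
apply: (monic_exp_inj n_gt0); rewrite ?map_monic ?char_poly_monic //.
by rewrite -rmorphXn /= eq_reg (splitting_char_poly _ split_phi).
Qed.

(** * A splitting that makes the subfield diagonal *)

(** The theorem of Cayley and Hamilton, pulled back along [phi] and [j]. *)
Lemma char_poly_root (F : fieldType) (A : falgType F) (K : fieldExtType F)
    (j : {lrmorphism K -> A}) n (phi : {rmorphism A -> 'M[K]_n}) (p : {poly F}) k :
    (0 < n)%N -> injective phi -> (forall c x, phi (c *: x) = c%:A *: phi x) ->
  map_poly (in_alg K) p = char_poly (phi (j k)) -> root (map_poly (in_alg K) p) k.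
Proof.
case: n phi => // n phi _ phi_inj phiZ def_p.
have horner_phi (q : {poly F}) :
    horner_mx (phi (j k)) (map_poly (in_alg K) q) = phi (j (map_poly (in_alg K) q).[k]).
  elim/poly_ind: q => [|q c IHq]; first by rewrite rmorph0 horner0 !rmorph0.
  rewrite rmorphD rmorphM /= map_polyX map_polyC /= hornerD hornerM hornerX hornerC.
  rewrite !rmorphD !rmorphM /= IHq horner_mx_X horner_mx_C; congr (_ + _).
  by rewrite rmorph_alg phiZ rmorph1 -scalemx1.
have := Cayley_Hamilton (phi (j k)); rewrite -def_p horner_phi -(rmorph0 phi).
by move=> /phi_inj/eqP; rewrite fmorph_eq0.
Qed.

Section DiagonalSplitting.
Variables (F : fieldType) (A : falgType F) (n : nat).
Hypotheses (simpleA : central_simple A) (dimA : \dim {:A} = (n ^ 2)%N).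
Variables (K : fieldExtType F) (j : {lrmorphism K -> A}).
Hypotheses (sepK : separable 1 {:K}) (dimK : \dim {:K} = n).

(** The conjugates over [E] of the characteristic polynomial of [phi x] have
    the same n-th power, the characteristic polynomial of the regular
    representation, which is defined over [F].  So they coincide, and the
    coefficients are fixed by all embeddings. *)
Lemma redcharpoly_exists (phi : {rmorphism A -> 'M[K]_n}) (x : A) :
  splitting (in_alg K) phi -> exists p, is_redcharpoly n x p.
Proof.
move=> split_phi; have n_gt0 : (0 < n)%N by rewrite -dimK adim_gt0.
have [E [sigma [theta [sigma_inj gen_theta sigmaF _]]]] :=
  exists_embeddings sepK dimK.
have /polyOver1P[p def_p] : char_poly (phi x) \is a polyOver 1%VS.
  apply/polyOverP => m; apply: (embeddings_fixed sigma_inj) => // i l.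
  rewrite -!coef_map /=.
  suff -> : map_poly (sigma i) (char_poly (phi x)) = map_poly (sigma l) (char_poly (phi x)).
    by [].
  apply: (monic_exp_inj n_gt0); rewrite ?map_monic ?char_poly_monic //.
  rewrite -!rmorphXn /= -(splitting_char_poly x split_phi) -!map_poly_comp.
  by apply: eq_map_poly => c; apply: sigmaF.
by exists p, K, (in_alg K), phi.
Qed.

(** The characteristic polynomial of [theta] is its minimal polynomial, which
    has [n] distinct roots in [E].  This provides [n] eigenvectors; they are
    independent because the [sigma i] are, and they are eigenvectors of all
    of [K] because [theta] generates [K].  They form the rows of [B]. *)
Lemma exists_diagonal_splitting : exists (E : fieldType) (iota : {rmorphism F -> E})
    (sigma : 'I_n -> {rmorphism K -> E}) (psi : {rmorphism A -> 'M[E]_n}),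
  [/\ forall c : 'I_n -> E, (forall k, \sum_i c i * sigma i k = 0) -> forall i, c i = 0,
      forall k, psi (j k) = diag_mx (\row_i sigma i k)
    & forall x, map_poly iota (redcharpoly n x) = char_poly (psi x)].
Proof.
have n_gt0 : (0 < n)%N by rewrite -dimK adim_gt0.
have [E [sigma [theta [sigma_inj gen_theta sigmaF split_min]]]] :=
  exists_embeddings sepK dimK.
have [phi [split_phi phi_inj]] := regular_splitting j dimA dimK simpleA.
pose i0 := Ordinal n_gt0.
pose iota : {rmorphism F -> E} := sigma i0 \o in_alg K.
pose psi0 x := map_mx (sigma i0) (phi x).
have sigma_free := embeddings_free sigma_inj.
have iotaE x : map_poly iota (redcharpoly n x) = char_poly (psi0 x).
  rewrite /psi0 -map_char_poly
    -(redcharpolyE n_gt0 split_phi (redcharpoly_exists x split_phi)).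
  by rewrite -map_poly_comp.
have psi0D x y : psi0 (x + y) = psi0 x + psi0 y by rewrite /psi0 rmorphD map_mxD.
have psi0B x y : psi0 (x - y) = psi0 x - psi0 y by rewrite /psi0 rmorphB map_mxB.
have psi0M x y : psi0 (x * y) = psi0 x *m psi0 y by rewrite /psi0 rmorphM map_mxM.
have psi0_1 : psi0 1 = 1%:M by rewrite /psi0 rmorph1 map_mx1.
have psi0F c : psi0 (j c%:A) = (iota c)%:M.
  by rewrite /psi0 rmorph_alg (split_phi.1 c 1) rmorph1 map_mxZ map_mx1 scalemx1.
have char_theta : char_poly (phi (j theta)) = minPoly 1 theta.
  have def_p := redcharpolyE n_gt0 split_phi (redcharpoly_exists (j theta) split_phi).
  have root_p := char_poly_root n_gt0 phi_inj split_phi.1 def_p.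
  apply/esym/eqP; rewrite -eqp_monic ?monic_minPoly ?char_poly_monic //.
  rewrite -def_p -dvdp_size_eqp; last first.
    by apply: minPoly_dvdp => //; apply/polyOver1P; exists (redcharpoly n (j theta)).
  by rewrite def_p size_char_poly size_minPoly adjoin_degreeE gen_theta dimv1 divn1 dimK.
have eigen i : exists v : 'rV_n, v *m psi0 (j theta) = sigma i theta *: v /\ v != 0.
  have /eigenvalueP[v vP v0] : eigenvalue (psi0 (j theta)) (sigma i theta).
    rewrite eigenvalue_root_char /psi0 -map_char_poly char_theta split_min.
    by rewrite /root horner_prod (bigD1 i) //= hornerXsubC subrr mul0r.
  by exists v.
have [v /all_and2[v_eig v0]] := fin_all_exists eigen.
have v_eigK i k : v i *m psi0 (j k) = sigma i k *: v i.
  have [q ->] := generator_poly gen_theta k.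
  elim/poly_ind: q => [|q c IHq].
    by rewrite rmorph0 horner0 !rmorph0 /psi0 rmorph0 map_mx0 mulmx0 scale0r.
  rewrite rmorphD rmorphM /= map_polyX map_polyC /= hornerD hornerM hornerX hornerC.
  rewrite !rmorphD psi0D mulmxDr !rmorphM psi0M mulmxA IHq -scalemxAl v_eig /=.
  by rewrite psi0F mul_mx_scalar scalerA scalerDl (sigmaF i i0).
pose B : 'M[E]_n := \matrix_i v i.
have uB : B \in unitmx.
  rewrite -row_free_unit -kermx_eq0; apply/eqP/row_matrixP => i; rewrite row0.
  have /sub_kermxP := row_sub i (kermx B); move: (row i _) => u uB.
  apply/rowP => l; rewrite [RHS]mxE.
  have [t vt0] : exists t, v l 0 t != 0.
    apply/existsP; apply: contraNT (v0 l) => /existsPn vl.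
    by apply/eqP/rowP => t; rewrite mxE; apply/eqP/negPn/vl.
  suff /sigma_free/(_ l)/eqP : forall k, \sum_s (u 0 s * v s 0 t) * sigma s k = 0.
    by rewrite mulf_eq0 (negPf vt0) orbF => /eqP.
  move=> k; have : (u *m B *m psi0 (j k)) 0 t = 0 by rewrite uB mul0mx mxE.
  rewrite -mulmxA mulmx_sum_row summxE => eq0; rewrite -[RHS]eq0; apply: eq_bigr => s _.
  by rewrite row_mul rowK v_eigK !mxE mulrCA mulrC.
pose f x := B *m psi0 x *m invmx B.
have f_add : zmod_morphism f by move=> x y; rewrite /f psi0B mulmxBr mulmxBl.
have f_mul : monoid_morphism f.
  split=> [|x y]; first by rewrite /f psi0_1 mulmx1 mulmxV.
  by rewrite -[RHS]/(f x *m f y) /f psi0M !mulmxA mulmxKV.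
pose fA := GRing.isZmodMorphism.Build A 'M[E]_n f f_add.
pose fM := GRing.isMonoidMorphism.Build A 'M[E]_n f f_mul.
pose psi : {rmorphism A -> 'M[E]_n} := HB.pack f fA fM.
exists E, iota, sigma, psi; split=> // [k|x].
  apply: (canLR (mulmxK uB)); apply/row_matrixP => i.
  by rewrite !row_mul rowK v_eigK row_diag_mx -scalemxAl -rowE mxE rowK.
rewrite iotaE; apply/esym/(char_poly_similar (B := B)); rewrite ?row_free_unit //.
by rewrite /= /f mulmxKV.
Qed.

End DiagonalSplitting.

(** * Kummer spaces *)

Theorem corollary44 (F : fieldType) (A : falgType F) (n : nat)
    (hA : central_simple A) (hn : \dim {:A} = (n ^ 2)%N)
    (K : fieldExtType F) (j : {lrmorphism K -> A})
    (hKmax : maximal_subfield (limg (linfun j)))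
    (hKsep : separable 1 {:K})
    (hKn : \dim {:K} = n)
    (a : A) :
  Kummer n (limg (linfun j) * <[a]>)%VS <->
  Kummer n (limg (linfun j) * <[a]> * limg (linfun j))%VS.
Proof.
have jK k : j k \in limg (linfun j) by rewrite -(lfunE j) memv_img ?memvf.
split=> KummerKa; last first.
  move=> v vKa; apply: KummerKa; rewrite -[v]mulr1 memv_mul //.
  by rewrite -(rmorph1 j) jK.
have [E [iota [sigma [psi [sigma_free psiK psi_char]]]]] :=
  exists_diagonal_splitting hA hn j hKsep hKn.
have coef_psi x i : (i <= n)%N -> rho n i x = 0 <->
    \sum_(S : {set 'I_n} | #|S| == i) pminor (psi x) S = 0.
  move=> le_in; rewrite /rho; have := coef_char_poly (psi x) le_in.
  rewrite -psi_char coef_map /= => eq_coef; split=> [/eqP|sum0].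
    rewrite mulf_eq0 signr_eq0 /= => /eqP r0; move/esym/eqP: eq_coef.
    by rewrite r0 rmorph0 mulf_eq0 signr_eq0 => /eqP.
  by move/eqP: eq_coef; rewrite sum0 mulr0 fmorph_eq0 => /eqP->; rewrite mulr0.
(* Here c keeps the minors of one size, that is one coefficient of the
   characteristic polynomial. *)
have minors0 (S : {set 'I_n}) : (0 < #|S| < n)%N -> pminor (psi a) S = 0.
  move=> cardS; pose c (T : {set 'I_n}) := if #|T| == #|S| then pminor (psi a) T else 0.
  suff /(_ S) : forall T, c T = 0 by rewrite /c eqxx.
  apply: (multilinear_eq0 (f := fun i => sigma i : {additive K -> E})) => // k.
  have /coef_psi : rho n #|S| (j k * a) = 0.
    by apply: KummerKa => //; rewrite memv_mul ?memv_line.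
  move=> /(_ (ltnW (andP cardS).2)) sum0; rewrite -[RHS]sum0 [RHS]big_mkcond.
  apply: eq_bigr => T _; rewrite /c; case: ifP => _; last by rewrite mul0r.
  have -> : psi (j k * a) = \matrix_(i, l) (sigma i k * psi a i l).
    rewrite rmorphM /= psiK; apply/matrixP => i l.
    by rewrite -[LHS]/((_ *m _) i l) mul_diag_mx !mxE.
  by rewrite pminor_scale_rows mulrC.
move=> v vKaK i /andP[i_gt0 lt_in]; apply/coef_psi; first exact: ltnW.
have supp_v : forall s t, psi a s t = 0 -> psi v s t = 0.
  move: v vKaK; apply: prodv_ind => [|x y supp_x supp_y|_ _
    /memv_cosetP[_ /memv_imgP[k _ ->] ->] /memv_imgP[k' _ ->]] s t ast0.
  - by rewrite rmorph0 mxE.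
  - by rewrite rmorphD mxE supp_x ?supp_y ?addr0.
  rewrite !lfunE !rmorphM /= !psiK.
  by rewrite -[LHS]/((_ *m _ *m _) s t) mul_mx_diag mul_diag_mx !mxE ast0 mulr0 mul0r.
by apply: big1 => S /eqP cardS; apply: (pminor_support minors0 supp_v); rewrite cardS i_gt0.
Qed.
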